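(* Let $X$ and $Y$ be Banach spaces and suppose that $Y$ has HFC$_p$ for some $p\in(1,\infty]$. (1) Suppose $p\in(1,\infty)$. If there is a coarse map $f\colon X\to Y$ which is linearly expanding at rate $1$, then $X$ has HFC$_p$. (2) Suppose $p=\infty$. If there is a coarse map $f\colon X\to Y$ which is expanding at rate $1$, then $X$ has HFC$_\infty$.
   Context: For $k\in\mathbb N$ and an infinite $\mathbb M\subseteq\mathbb N$, $[\mathbb M]^k$ denotes the set of all $k$-element subsets of $\mathbb M$, written $\bar n=(n_1,\dots,n_k)$ with $n_1<\dots<n_k$. The Hamming metric on $[\mathbb N]^k$ is $d_{\mathbb H}(\bar n,\bar m)=|\{i\in\{1,\dots,k\}: n_i\ne m_i\}|$. For $p\in(1,\infty]$, a Banach space $X$ has HFC$_p$ (the Hamming full concentration property for $p$) if there is $C\ge1$ such that for all $k\in\mathbb N$ and all $1$-Lipschitz maps $\phi\colon([\mathbb N]^k,d_{\mathbb H})\to X$ there is an infinite $\mathbb M\subseteq\mathbb N$ such that $\mathrm{diam}(\phi([\mathbb M]^k))\le Ck^{1/p}$ (with $1/\infty=0$). A map $f\colon X\to Y$ between Banach spaces is coarse if $\omega_f(t)=\sup\{\|f(x)-f(z)\| : \|x-z\|\le t\}<\infty$ for all $t\ge 0$. A map $f\colon X\to Y$ between Banach spaces is expanding at rate $1$ if for every $L>0$ there is a map $\rho\colon[0,\infty)\to[0,\infty)$ with $\lim_{t\to\infty}\rho(t)=\infty$ such that, for all $x,z\in X$, $\|x-z\|\ge L\max\{\|x\|,\|z\|\}+L$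 implies $\|f(x)-f(z)\|\ge\rho(\|x-z\|)$. It is linearly expanding at rate $1$ if for every $L>0$ there is $C>0$ such that, for all $x,z\in X$, $\|x-z\|\ge L\max\{\|x\|,\|z\|\}+L$ implies $\|f(x)-f(z)\|\ge\frac1C\|x-z\|-C$. *)

(* Defs.v *)
From HB Require Import structures.
From mathcomp Require Import all_boot all_order all_algebra.
From mathcomp Require Import all_classical all_reals all_analysis.

Set Implicit Arguments.
Unset Strict Implicit.
Unset Printing Implicit Defensive.

Import Order.TTheory GRing.Theory Num.Theory.
Import numFieldNormedType.Exports.

Local Open Scope classical_set_scope.
Local Open Scope ring_scope.

(* A k-element subset of nat is encoded by its increasing enumeration. *)
Definition ksubset (k : nat) : Type :=
  {n : k.-tuple nat | sorted ltn n}.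

Definition ksubsets_of {k : nat} (M : set nat) : set (ksubset k) :=
  [set n | forall i : 'I_k, M (tnth (sval n) i)].

Definition hamming (k : nat) (n m : ksubset k) : nat :=
  #|[set i : 'I_k | tnth (sval n) i != tnth (sval m) i]%SET|.

Section Banach.
Context {R : realType}.

Definition diam (X : normedModType R) (A : set X) : \bar R :=
  ereal_sup [set `|x - y|%:E | x in A & y in A].

Definition hamming_lipschitz1 (X : normedModType R) (k : nat)
    (phi : ksubset k -> X) : Prop :=
  forall n m, `|phi n - phi m| <= (hamming n m)%:R.

(* In \bar R the inverse of +oo is 0, so the exponent is 0 for p = +oo. *)
Definition HFC (p : \bar R) (X : completeNormedModType R) : Prop :=
  exists2 C : R, 1 <= C &
    forall (k : nat) (phi : ksubset k -> X), hamming_lipschitz1 phi ->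
      exists2 M : set nat, infinite_set M &
        (diam (phi @` ksubsets_of M) <= (C * k%:R `^ fine (p^-1))%:E)%E.

Definition modulus (X Y : normedModType R) (f : X -> Y) (t : R) : \bar R :=
  ereal_sup [set `|f xz.1 - f xz.2|%:E | xz in [set xz | `|xz.1 - xz.2| <= t]].

Definition coarse (X Y : normedModType R) (f : X -> Y) : Prop :=
  forall t : R, 0 <= t -> (modulus f t < +oo)%E.

Definition expanding_at_rate1 (X Y : normedModType R) (f : X -> Y) : Prop :=
  forall L : R, 0 < L -> exists rho : R -> R,
    [/\ forall t, 0 <= t -> 0 <= rho t,
        rho t @[t --> +oo] --> +oo &
        forall x z, L * Num.max `|x| `|z| + L <= `|x - z| ->
          rho `|x - z| <= `|f x - f z|].

Definition linearly_expanding_at_rate1 (X Y : normedModType R)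
    (f : X -> Y) : Prop :=
  forall L : R, 0 < L -> exists2 C : R, 0 < C &
    forall x z, L * Num.max `|x| `|z| + L <= `|x - z| ->
      C^-1 * `|x - z| - C <= `|f x - f z|.

End Banach.

(* Main.v *)
Require Import Defs.
From mathcomp Require Import all_boot all_order all_algebra.
From mathcomp Require Import all_classical all_reals all_analysis.
From mathcomp Require Import lra.

(** The map [f] is Lipschitz at large distances, so the property of [Y] applies
to [f \o phi] for every Hamming-Lipschitz [phi] into [X]. If [phi] has diameter
at most [S] on [[M]^k], translate it by one of its values so that its norm is at
most [S] there, and concentrate [f \o phi] on a subset [M'] of [M]. Two values
of [phi] on [[M']^k] at distance more than [S/2] satisfy the rate-1 condition
with [L = 1/4], so expansion bounds their distance by a multiple of
[k^(1/p)]. Hence one passage to a subset halves the diameter until it reaches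
this order of magnitude, and finitely many passages suffice because the
diameter is at most [k] at the start. *)

Set Implicit Arguments.
Unset Strict Implicit.
Unset Printing Implicit Defensive.

Import Order.TTheory GRing.Theory Num.Theory.
Import numFieldNormedType.Exports.

Local Open Scope classical_set_scope.
Local Open Scope ring_scope.

Lemma increasing_seq_ltn (e : nat -> nat) :
  increasing_seq e -> {mono e : i j / (i < j)%N}.
Proof. by move=> he; apply: leqW_mono => i j; exact: he. Qed.

Lemma ksubset_map_sorted (k : nat) (e : nat -> nat) (he : increasing_seq e)
    (n : ksubset k) : sorted ltn (map_tuple e (sval n)).
Proof. by rewrite /= (mono_sorted (increasing_seq_ltn he)); exact: (svalP n). Qed.

(** Reindexing along an increasing sequence in an infinite set replaces restriction to that set: the
    new map is again defined on all of [ksubset k], so concentration can be applied to it anew. *)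
Definition ksubset_map (k : nat) (e : nat -> nat) (he : increasing_seq e)
    (n : ksubset k) : ksubset k :=
  exist _ (map_tuple e (sval n)) (ksubset_map_sorted he n).

Lemma ksubset_eq (k : nat) (n m : ksubset k) :
  (forall i, tnth (sval n) i = tnth (sval m) i) -> n = m.
Proof.
case: n m => [n hn] [m hm] /= nm; have {}nm := eq_from_tnth nm.
by subst m; rewrite (Prop_irrelevance hn hm).
Qed.

Lemma increasing_seq_comp (e e' : nat -> nat) :
  increasing_seq e -> increasing_seq e' -> increasing_seq (e \o e').
Proof. by move=> he he' i j; exact: (etrans (he _ _) (he' _ _)). Qed.

Lemma ksubset_map_comp (k : nat) (e e' : nat -> nat) (he : increasing_seq e)
    (he' : increasing_seq e') (n : ksubset k) :
  ksubset_map (increasing_seq_comp he he') n =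
  ksubset_map he (ksubset_map he' n).
Proof. by apply: ksubset_eq => i; rewrite !tnth_map. Qed.

Lemma hamming_map (k : nat) (e : nat -> nat) (he : increasing_seq e)
    (n m : ksubset k) :
  hamming (ksubset_map he n) (ksubset_map he m) = hamming n m.
Proof.
apply: eq_card => i; rewrite !inE !tnth_map.
by rewrite (inj_eq (increasing_seq_injective he)).
Qed.

Lemma hamming_le (k : nat) (n m : ksubset k) : (hamming n m <= k)%N.
Proof. by rewrite -[leqRHS]card_ord max_card. Qed.

Lemma ksubset_iota (k : nat) : ksubset k.
Proof. by exists (iota_tuple k 0); exact: iota_ltn_sorted. Qed.

Lemma ksubsets_of_range (k : nat) (e : nat -> nat) (he : increasing_seq e)
    (n : ksubset k) :
  ksubsets_of (range e) n -> exists n', n = ksubset_map he n'.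
Proof.
move=> ne; have /choice[g gP] : forall i, exists j, e j = tnth (sval n) i.
  by move=> i; have [j _ <-] := ne i; exists j.
have en : map_tuple e [tuple g i | i < k] = sval n.
  by apply: eq_from_tnth => i; rewrite !tnth_map tnth_ord_tuple gP.
set t := [tuple g i | i < k] in en.
have ht : sorted ltn t.
  rewrite -(mono_sorted (increasing_seq_ltn he)).
  by have := svalP n; rewrite -en.
by exists (exist (fun s : k.-tuple nat => sorted ltn s) t ht); apply: ksubset_eq => i; rewrite /= en.
Qed.

Section HammingConcentration.
Context {R : realType}.

Lemma diamP (X : normedModType R) (A : set X) (d : R) :
  (diam A <= d%:E)%E <-> forall x y, A x -> A y -> `|x - y| <= d.
Proof.
split=> [Ad x y Ax Ay|Ad].
  rewrite -lee_fin; apply: le_trans Ad; apply: ereal_sup_ubound.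
  by exists x => //; exists y.
by apply: ge_ereal_sup => _ [x Ax [y Ay <-]]; rewrite lee_fin Ad.
Qed.

Lemma infinite_increasing_enum (M : set nat) : infinite_set M ->
  exists2 e : nat -> nat, increasing_seq e & forall i, M (e i).
Proof.
move=> Moo.
have [|e [he _ eM]] := @infinite_increasing_seq_wf _ nat M _ Moo 0%N.
  move=> x; apply: (sub_finite_set _ (finite_II x.+1)) => y /=.
  by rewrite leEnat ltnS.
by exists e.
Qed.

(** Given [M], take an increasing sequence inside it; given [e], take its range, whose [k]-subsets
    are all images under [ksubset_map]. *)
Lemma diam_subseqP (X : normedModType R) (k : nat) (phi : ksubset k -> X)
    (d : R) :
  (exists2 M : set nat, infinite_set M &
     (diam (phi @` ksubsets_of M) <= d%:E)%E) <->
  (exists (e : nat -> nat) (he : increasing_seq e), forall n m,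
     `|phi (ksubset_map he n) - phi (ksubset_map he m)| <= d).
Proof.
split=> [[M /infinite_increasing_enum[e he eM] /diamP Md]|[e [he hd]]].
  have eMk n : ksubsets_of M (@ksubset_map k e he n).
    by move=> i; rewrite tnth_map.
  exists e, he => n m.
  by apply: Md; [exists (ksubset_map he n)|exists (ksubset_map he m)].
exists (range e).
  move=> /(@finite_preimage _ _ _ e) fin; apply: infinite_nat.
  rewrite -(preimage_range e); apply: fin => i j _ _.
  exact: increasing_seq_injective.
apply/diamP => _ _ [n ne <-] [m me <-].
have [n' ->] := ksubsets_of_range he ne.
by have [m' ->] := ksubsets_of_range he me.
Qed.

(* Chaining along the segment from [z] to [x]. *)
Lemma coarse_lipschitz (X Y : normedModType R) (f : X -> Y) : coarse f ->
  exists2 w : R, 1 <= w &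
    forall (N : nat) (x z : X), `|x - z| <= N%:R -> `|f x - f z| <= w * N%:R.
Proof.
move=> /(_ 1 ler01) f1.
have [w w1 fw] : exists2 w : R, 1 <= w &
    forall x z : X, `|x - z| <= 1 -> `|f x - f z| <= w.
  (* Coarseness makes the modulus finite, so [fine] keeps its value; the maximum with 1 makes
     division by [w] possible later. *)
  exists (Num.max 1 (fine (modulus f 1))) => [|x z xz].
    by rewrite le_max lexx.
  rewrite le_max; apply/orP; right.
  have le_sup : (`|f x - f z|%:E <= modulus f 1)%E.
    by apply: ereal_sup_ubound; exists (x, z).
  rewrite -lee_fin fineK// ge0_fin_numE//.
  by apply: le_trans le_sup; rewrite lee_fin.
exists w => //; elim=> [|N IH] x z.
  by rewrite normr_le0 subr_eq0 => /eqP ->; rewrite subrr normr0 mulr0.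
move=> xz; pose t : R := N%:R / N.+1%:R; pose y := z + t *: (x - z).
have N1 : 0 < N.+1%:R :> R by rewrite ltr0n.
have t0 : 0 <= t by rewrite divr_ge0.
have tE : 1 - t = N.+1%:R^-1.
  by rewrite /t -[X in X - _](divff (lt0r_neq0 N1)) -mulrBl -natr1 addrC addKr mul1r.
have xy : `|x - y| <= 1.
  have -> : x - y = (1 - t) *: (x - z).
    by rewrite /y opprD addrA scalerBl scale1r.
  by rewrite normrZ tE ger0_norm ?invr_ge0 ?ler0n// ler_pdivrMl// mulr1.
have yz : `|y - z| <= N%:R.
  rewrite /y addrC addKr normrZ ger0_norm//.
  by rewrite /t -mulrA ler_piMr// ler_pdivrMl// mulr1.
apply: le_trans (ler_distD (f y) _ _) _.
by rewrite -natr1 mulrDr mulr1 addrC lerD ?IH ?fw.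
Qed.

(** Hamming distances are natural numbers, so the chained bound applies without rounding; dividing
    by [w] restores the Lipschitz constant 1 that [HFC] demands. *)
Lemma coarse_comp_lipschitz (X Y : completeNormedModType R) (f : X -> Y) :
  coarse f -> exists2 w : R, 0 < w &
    forall (k : nat) (phi : ksubset k -> X), hamming_lipschitz1 phi ->
      hamming_lipschitz1 (fun n => w^-1 *: f (phi n)).
Proof.
move=> /coarse_lipschitz[w w1 fw]; have w0 := lt_le_trans ltr01 w1.
exists w => // k phi hphi n m; rewrite -scalerBr normrZ.
by rewrite gtr0_norm ?invr_gt0// ler_pdivrMl// fw.
Qed.

Lemma hamming_lipschitz1_map (X : normedModType R) (k : nat)
    (phi : ksubset k -> X) (e : nat -> nat) (he : increasing_seq e) :
  hamming_lipschitz1 phi ->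
  hamming_lipschitz1 (fun n => phi (ksubset_map he n)).
Proof. by move=> hphi n m; rewrite -(hamming_map he). Qed.

(** Common consequence of both kinds of expansion, taken at [L = 1/4], with [q] standing for [1/p].
    The constant [B] is uniform in [k], and [1 <= k^q] lets additive constants be absorbed. *)
Definition rate1_controlled (X Y : normedModType R) (f : X -> Y) (q : R) :=
  forall A : R, exists2 B : R, 1 <= B & forall (k : nat) (x z : X),
    1 <= k%:R `^ q :> R ->
    4^-1 * Num.max `|x| `|z| + 4^-1 <= `|x - z| ->
    `|f x - f z| <= A * k%:R `^ q -> `|x - z| <= B * k%:R `^ q.

Lemma linearly_expanding_controlled (X Y : normedModType R) (f : X -> Y)
    (q : R) : linearly_expanding_at_rate1 f -> rate1_controlled f q.
Proof.
move=> hf A; have [|C C0 fC] := hf 4^-1; first by rewrite invr_gt0.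
exists (Num.max 1 (C * (A + C))) => [|k x z s1 /fC]; first by rewrite le_max lexx.
set s := k%:R `^ q in s1 *; move=> lb ub.
have : C^-1 * `|x - z| <= (A + C) * s.
  have Cs : C <= C * s by rewrite ler_peMr// ltW.
  by rewrite mulrDl; lra.
rewrite ler_pdivrMl// mulrA => /le_trans; apply.
by rewrite ler_wpM2r ?powR_ge0// le_max lexx orbT.
Qed.

(** For [q = 0] the bound on the images is the constant [A]; since [rho] exceeds [A] beyond some
    [T], the distance is at most [T]. *)
Lemma expanding_controlled (X Y : normedModType R) (f : X -> Y) :
  expanding_at_rate1 f -> rate1_controlled f 0.
Proof.
move=> hf A; have [|rho [_ rhoy frho]] := hf 4^-1; first by rewrite invr_gt0.
have [T [_ hT]] := cvgry_gt rhoy A.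
exists (Num.max 1 T) => [|k x z _ /frho]; first by rewrite le_max lexx.
rewrite powRr0 !mulr1 => lb ub.
rewrite leNgt gt_max; apply/negP => /andP[_ /hT].
by rewrite ltNge (le_trans lb ub).
Qed.

Lemma HFC_halving (p : \bar R) (X Y : completeNormedModType R) (f : X -> Y) :
  HFC p Y -> coarse f -> rate1_controlled f (fine p^-1) ->
  exists2 B : R, 1 <= B & forall (k : nat) (phi : ksubset k -> X) (S : R),
    1 <= k%:R `^ fine p^-1 :> R -> hamming_lipschitz1 phi -> 1 <= S ->
    (forall n m, `|phi n - phi m| <= S) ->
    exists (e : nat -> nat) (he : increasing_seq e), forall n m,
      `|phi (ksubset_map he n) - phi (ksubset_map he m)|
        <= Num.max (S / 2) (B * k%:R `^ fine p^-1).
Proof.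
(* The factor [w * C] is the concentration constant of [Y] after undoing the rescaling by [w]. *)
move=> [C C1 YC] /coarse_comp_lipschitz[w w0 fw] /(_ (w * C))[B B1 fB].
exists B => // k phi S s1 hphi S1 phiS.
pose v := phi (ksubset_iota k).
have hpsi : hamming_lipschitz1 (fun n => phi n - v).
  by move=> n m; rewrite opprB addrA subrK.
have /diam_subseqP[e [he fe]] := YC _ _ (fw _ _ hpsi).
exists e, he => n m; rewrite le_max.
have [//|far /=] := leP _ (S / 2).
set n' := ksubset_map he n; set m' := ksubset_map he m.
have nmE : phi n' - phi m' = (phi n' - v) - (phi m' - v).
  by rewrite opprB addrA subrK.
rewrite nmE; apply: fB => //.
  (* Both translated norms are at most [S], and [1 <= S], so [S/4 + 1/4 <= S/2]. *)
  rewrite -nmE; apply: le_trans (ltW far).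
  have : Num.max `|phi n' - v| `|phi m' - v| <= S by rewrite ge_max !phiS.
  by lra.
have := fe n m; rewrite -scalerBr normrZ gtr0_norm ?invr_gt0//.
by rewrite ler_pdivrMl// mulrA.
Qed.

Lemma HFC_transfer (p : \bar R) (X Y : completeNormedModType R) (f : X -> Y) :
  (0 <= p)%E -> HFC p Y -> coarse f -> rate1_controlled f (fine p^-1) ->
  HFC p X.
Proof.
move=> p0 hY cf /(HFC_halving hY cf)[B B1 halve].
exists B => // k phi hphi; apply/diam_subseqP.
have B0 : 0 <= B by rewrite (le_trans ler01).
have hid : increasing_seq (@id nat) by [].
case: k phi hphi => [|k] phi hphi.
  exists id, hid => n m; apply: (@le_trans _ _ 0); last by rewrite mulr_ge0 ?powR_ge0.
  apply: le_trans (hphi _ _) _.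
  by rewrite lern0 -leqn0 hamming_le.
set b := B * _.
have s1 : 1 <= k.+1%:R `^ fine p^-1 :> R.
  have q0 : 0 <= fine p^-1 by rewrite fine_ge0// inve_ge0.
  rewrite -[X in X <= _](powRr0 k.+1%:R).
  by apply: ler_powR; rewrite ?ler1n.
have b1 : 1 <= b by rewrite mulr_ege1.
have iterate (j : nat) : exists (e : nat -> nat) (he : increasing_seq e),
    forall n m, `|phi (ksubset_map he n) - phi (ksubset_map he m)|
      <= Num.max (k.+1%:R / 2 ^+ j) b.
  elim: j => [|j [e [he IH]]].
    exists id, hid => n m; rewrite expr0 divr1 le_max.
    by rewrite (le_trans (hphi _ _))// ler_nat hamming_le.
  have [|e' [he' IH']] := halve _ _ _ s1 (hamming_lipschitz1_map he hphi) _ IH.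
    by rewrite le_max b1 orbT.
  exists (e \o e'), (increasing_seq_comp he he') => n m.
  rewrite !ksubset_map_comp; apply: le_trans (IH' n m) _.
  rewrite -/b exprSr invfM mulrA.
  set a := k.+1%:R / 2 ^+ j; rewrite ge_max !le_max lexx orbT andbT.
  (* Once [a] has dropped to [b] or below, the bound [b] persists, as [b / 2 <= b]; before that, [a]
     is halved. *)
  by case: (leP a b) => ab; apply/orP; [right; lra|left].
(* As many rounds as the size of the subsets suffice: [n < 2^n] brings the first term below 1, hence
   below [b]. *)
have [e [he hb]] := iterate k.+1.
exists e, he => n m; apply: le_trans (hb n m) _.
rewrite ge_max lexx andbT; apply: le_trans b1.
rewrite ler_pdivrMr ?exprn_gt0// mul1r -natrX ler_nat.
by rewrite ltnW// ltn_expl.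
Qed.

End HammingConcentration.

Theorem theorem1p5 (R : realType) (X Y : completeNormedModType R)
    (p : \bar R) (hp : (1 < p)%E) (hY : HFC p Y) :
  ((p < +oo)%E ->
    (exists f : X -> Y, coarse f /\ linearly_expanding_at_rate1 f) ->
    HFC p X) /\
  (p = +oo%E ->
    (exists f : X -> Y, coarse f /\ expanding_at_rate1 f) ->
    HFC +oo%E X).
Proof.
have p0 : (0 <= p)%E by apply: ltW; apply: lt_trans hp; rewrite lte_fin ltr01.
split=> [_ [f [cf lf]]|py [f [cf ef]]].
  exact: (HFC_transfer p0 hY cf (linearly_expanding_controlled _ lf)).
subst p; apply: (HFC_transfer p0 hY cf).
by rewrite invey; exact: expanding_controlled ef.
Qed.
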